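(* Let $0<k<n$, $V=\mathbb{C}^n$, and let $\omega=(2,\dots,k,n)\in\binom{[n]}{k}$. Let $t_2,\dots,t_n\in\mathbb{C}$ be distinct points such that $$X:=X_{\omega}(\infty)\cap X_{\square}(t_2)\cap\cdots\cap X_\square(t_n)$$ is a real osculating instance of the Schubert problem $(\omega,\square^{n-1})$ on $\mathrm{Gr}(k,V)$. Let $f(t)$ be the polynomial of degree $n-1$ whose roots are $t_2,\dots,t_n$, normalized so that $f'(t)$ is monic. Then the number of real points in $X$ is equal to the number of factorizations $f'(t)=A(t)B(t)$ such that $A(t)$ and $B(t)$ are monic real polynomials of degree $n-k-1$ and $k-1$, respectively.
   Context: $V=\mathbb{C}^n$ (row vectors) with its standard real structure. Schubert conditions are increasing $k$-tuples $\alpha\in\binom{[n]}{k}$ from $[n]$; $X_\alpha F_\bullet=\{H\in \mathrm{Gr}(k,V):\dim(H\cap F_{\alpha_i})\ge i,\ i\in[k]\}$ for a complete flag $F_\bullet$ ($\dim F_i=i$). $\square=(n-k,n-k+2,n-k+3,\dots,n)$ is the unique condition defining hypersurface Schubert varieties, and $\square^{n-1}$ means $\square$ repeated $n-1$ times. Fix a real parametrized rational normal curve $\gamma$ in $\mathbb{P}^{n-1}$ (components are a basis of real forms of degree $n-1$ on $\mathbb{P}^1$), e.g. $\gamma(t)=(1,t,\dots,t^{n-1})$. For $a\in\mathbb{C}$, the osculating flag $F_\bullet(a)$ has $F_i(a)=\mathrm{span}(\gamma(a),\gamma'(a),\dots,\gamma^{(i-1)}(a))$, and $F_\bullet(\infty)$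 is defined in the same way using a local parameter of $\mathbb{P}^1$ at $\infty$ on the homogenized curve. $X_\alpha(a):=X_\alpha F_\bullet(a)$. The instance $X$ is a real osculating instance if it is stable under complex conjugation, equivalently $\{t_2,\dots,t_n\}$ is stable under complex conjugation. A point $H\in X$ is real if $H=\overline H$. Factorizations are counted as ordered pairs $(A,B)$. *)

(* Defs.v *)
From HB Require Import structures.
From mathcomp Require Export all_boot all_order all_algebra.
From mathcomp Require Export classical_sets cardinality reals.
From mathcomp Require Export complex.

Set Implicit Arguments.
Unset Strict Implicit.
Unset Printing Implicit Defensive.

Import GRing.Theory.
Local Open Scope classical_set_scope.
Local Open Scope ring_scope.

Section Schubert.
Variables (K : fieldType) (V : vectType K).

Definition Gr (k : nat) : set {vspace V} := [set H | \dim H = k].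

(* alpha_(i+1), which the literature indexes from 1, is [nth 0 alpha i], and
   F j is the j-dimensional member of the flag. *)
Definition schubert_variety (alpha : seq nat) (F : nat -> {vspace V}) :
    set {vspace V} :=
  Gr (size alpha) `&`
  [set H | forall i : nat, (i < size alpha)%N ->
             (i.+1 <= \dim (H :&: F (nth 0%N alpha i))%VS)%N].

End Schubert.

Definition schubert_condition (n k : nat) (alpha : seq nat) : bool :=
  [&& size alpha == k, sorted ltn alpha & all (fun j => 0 < j <= n)%N alpha].

(* (2, ..., k, n) *)
Definition omega_cond (n k : nat) : seq nat := rcons (iota 2 k.-1) n.

(* (n-k, n-k+2, n-k+3, ..., n) *)
Definition box_cond (n k : nat) : seq nat :=
  (n - k)%N :: iota (n - k + 2) k.-1.

Lemma omega_condP (n k : nat) :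
  (0 < k < n)%N -> schubert_condition n k (omega_cond n k).
Proof.
case/andP; case: k => // k _ lt_kn.
rewrite /schubert_condition /omega_cond size_rcons size_iota eqxx /=.
apply/andP; split; last first.
  rewrite all_rcons leqnn (leq_trans _ lt_kn) //=.
  apply/allP=> j; rewrite mem_iota => /andP[j2 jk].
  by rewrite (leq_trans _ j2) //= ltnW // (leq_trans jk).
rewrite (sorted_pairwise ltn_trans) pairwise_rcons -(sorted_pairwise ltn_trans).
rewrite iota_ltn_sorted andbT; apply/allP => j; rewrite mem_iota.
by move=> /andP[_ /leq_trans]; apply.
Qed.

Lemma box_condP (n k : nat) :
  (0 < k < n)%N -> schubert_condition n k (box_cond n k).
Proof.
case/andP; case: k => // k _ lt_kn.
rewrite /schubert_condition /box_cond /= size_iota eqxx /= subn_gt0 lt_kn.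
rewrite leq_subr /=; apply/andP; split; last first.
  apply/allP=> j; rewrite mem_iota => /andP[j2 jk].
  rewrite (leq_trans _ j2) ?addn2 //= -ltnS (leq_trans jk) //.
  by rewrite addn2 !addSn -addnS subnK ?ltnSn // ltnW.
rewrite path_sortedE; last exact: ltn_trans.
rewrite iota_ltn_sorted andbT; apply/allP=> j; rewrite mem_iota => /andP[j2 _].
by rewrite /= (leq_trans _ j2) // addn2.
Qed.

Section Conjugation.
Variables (R : rcfType) (n : nat).

Definition conj_vspace (H : {vspace 'rV[R[i]]_n}) : {vspace 'rV[R[i]]_n} :=
  <<[seq map_mx (@conjc R) v | v <- vbasis H]>>%VS.

Definition real_point (H : {vspace 'rV[R[i]]_n}) : Prop := H = conj_vspace H.

Lemma map_mx_conjcK : involutive (map_mx (@conjc R) : 'rV[R[i]]_n -> 'rV_n).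
Proof. by move=> v; apply/rowP=> j; rewrite !mxE conjcK. Qed.

Lemma memv_conj_vspace (H : {vspace 'rV[R[i]]_n}) (v : 'rV[R[i]]_n) :
  (v \in conj_vspace H) = (map_mx (@conjc R) v \in H).
Proof.
have sumE (a : 'I_(\dim H) -> R[i]) (w : 'I_(\dim H) -> 'rV[R[i]]_n) :
    map_mx (@conjc R) (\sum_i a i *: w i) =
    \sum_i (a i)^*%C *: map_mx (@conjc R) (w i).
  apply/rowP=> j; rewrite !mxE !summxE rmorph_sum /=.
  by apply: eq_bigr => i _; rewrite !mxE rmorphM.
apply/idP/idP=> [|Hv]; last first.
  rewrite -[v]map_mx_conjcK (coord_vbasis Hv) sumE.
  apply: memv_suml => i _; apply/memvZ/memv_span/map_f/mem_nth.
  by rewrite size_tuple.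
move=> vH.
have {}vH : v \in <<map_tuple (map_mx (@conjc R)) (vbasis H)>>%VS by [].
rewrite (coord_span vH) sumE.
apply: memv_suml => i _; apply: memvZ.
rewrite (nth_map 0) ?size_tuple // map_mx_conjcK.
by apply/vbasis_mem/mem_nth; rewrite size_tuple.
Qed.

End Conjugation.

Section Osculating.
Variables (R : rcfType) (n : nat).

Implicit Types (c : 'I_n -> {poly R[i]}) (gamma : n.-tuple {poly_n R}).

(* the flag spanned by the successive derivatives at a of the curve with
   components c_0, ..., c_(n-1) *)
Definition derivative_flag c (a : R[i]) (i : nat) : {vspace 'rV[R[i]]_n} :=
  <<[seq (\row_j (c j)^`(m).[a]) | m <- iota 0 i]>>%VS.

(* A real form s^(n-1) g(t/s) of degree n-1 on P^1 is given by its
   dehomogenization g, a polynomial of size at most n. *)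
Definition rational_normal_curve gamma : bool := basis_of fullv gamma.

Definition affine_component gamma (j : 'I_n) : {poly R[i]} :=
  map_poly (real_complex R) (tnth gamma j : {poly R}).

(* s^(n-1) g(1/s), the expression of the same form in the local parameter
   s = 1/t at infinity *)
Definition component_at_infty gamma (j : 'I_n) : {poly R[i]} :=
  \poly_(i < n) (affine_component gamma j)`_(n.-1 - i).

Definition osculating_flag gamma (a : R[i]) : nat -> {vspace 'rV[R[i]]_n} :=
  derivative_flag (affine_component gamma) a.

Definition osculating_flag_infty gamma : nat -> {vspace 'rV[R[i]]_n} :=
  derivative_flag (component_at_infty gamma) 0.

(* X_omega(infty) /\ X_box(t_2) /\ ... /\ X_box(t_n) *)
Definition osculating_instance gamma (k : nat) (t : n.-1.-tuple R[i]) :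
    set {vspace 'rV[R[i]]_n} :=
  schubert_variety (omega_cond n k) (osculating_flag_infty gamma) `&`
  [set H | forall i : 'I_n.-1,
     schubert_variety (box_cond n k) (osculating_flag gamma (tnth t i)) H].

Definition conj_stable (X : set {vspace 'rV[R[i]]_n}) : Prop :=
  [set conj_vspace H | H in X] `<=` X.

End Osculating.

Definition real_factorizations (R : rcfType) (g : {poly R[i]}) (d e : nat) :
    set ({poly R} * {poly R}) :=
  [set AB | [/\ AB.1 \is monic, AB.2 \is monic,
                size AB.1 = d.+1, size AB.2 = e.+1 &
                g = map_poly (real_complex R) (AB.1 * AB.2)]].

(* Main.v *)
From HB Require Import structures.
Require Import Defs.
From mathcomp Require Import zify.

(** Sending c(a) to (X - a)^(n-1) identifies C^n with the polynomials of degree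
    less than n; the osculating space F_j(a) becomes the multiples of
    (X - a)^(n-j), and F_j(oo) the polynomials of degree less than j.  A point H
    of X then contains a hyperplane U of the polynomials of degree at most
    m = k - 1, which is the kernel of p |-> L_A(p) for an A of degree at most m,
    where L_A(p) = sum_j (-1)^j p^(j) A^(m-j) is constant whenever deg p <= m.
    For g in H outside U, the conditions at the t_i say that L_A(g) vanishes at
    all t_i, so L_A(g) is a multiple of f; differentiating,
    f' is a multiple of g^(m+1) A.  Conversely every monic factor A of degree m
    of f' gives the point {p | L_A(p) in C f} of X.  This bijection commutes with
    complex conjugation, so real points correspond to real factorizations. *)

Set Implicit Arguments.
Unset Strict Implicit.
Unset Printing Implicit Defensive.

Import Order.TTheory GRing.Theory Num.Theory.

Local Open Scope classical_set_scope.
Local Open Scope card_scope.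
Local Open Scope ring_scope.

(** * Derivatives in characteristic zero and the apolarity form *)

Section ApolarForm.
Variable F : numFieldType.
Implicit Types (p q A : {poly F}) (m : nat).

Lemma deriv_eq0_const p : p^`() = 0 -> p = (p`_0)%:P.
Proof.
move=> dp; apply/polyP=> -[|i]; rewrite coefC //=.
have := congr1 (fun q : {poly F} => q`_i) dp; rewrite coef_deriv coef0 /=.
by move/eqP; rewrite mulrn_eq0 => /eqP.
Qed.

Lemma derivn_eq0_size p m : (p^`(m) == 0) = (size p <= m)%N.
Proof.
apply/eqP/idP => [dp|]; last exact: derivn_poly0.
apply/leq_sizeP => j le_mj.
have := congr1 (fun q : {poly F} => q`_(j - m)) dp.
rewrite coef_derivn coef0 subnKC // => /eqP; rewrite mulrn_eq0 => /orP[|/eqP//].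
by rewrite -leqn0 leqNgt ffact_gt0 le_mj.
Qed.

Lemma size_derivn p m : size p^`(m) = (size p - m)%N.
Proof.
apply/eqP; rewrite eqn_leq; apply/andP; split.
  apply/leq_sizeP => j le_j; rewrite coef_derivn nth_default ?mul0rn -?leq_subLR //.
case: (leqP (size p) m) => [le_pm|lt_mp]; first by rewrite (eqP le_pm).
have /eqP : p^`(m)`_(size p - m).-1 != 0.
  rewrite coef_derivn; have -> : (m + (size p - m).-1 = (size p).-1)%N by lia.
  rewrite mulrn_eq0 negb_or -lead_coefE lead_coef_eq0 -lt0n ffact_gt0.
  by rewrite -ltnS (ltn_predK lt_mp) lt_mp -size_poly_gt0 (leq_ltn_trans _ lt_mp).
move/eqP; apply: contraNT; rewrite -ltnNge => lt.
by rewrite nth_default // -ltnS prednK ?subn_gt0.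
Qed.


Lemma exists_derivn p m : exists q, q^`(m) = p.
Proof.
elim: m => [|m [q <-]]; first by exists p.
(* At [i = 0] the inverse of zero is zero, so this primitive has constant term zero. *)
exists (\poly_(i < (size q).+1) (q`_i.-1 / i%:R)); rewrite derivSn; congr _^`(m).
apply/polyP=> i; rewrite coef_deriv coef_poly /= ltnS.
case: ltnP => [lt_i|le_i]; last by rewrite mul0rn nth_default.
by rewrite -[LHS]mulr_natr divfK // pnatr_eq0.
Qed.

Lemma derivn_root p a m j :
  (j < m)%N -> ('X - a%:P) ^+ m %| p -> (p^`(j)).[a] = 0.
Proof.
move=> lt_jm dvd.
suff: ('X - a%:P) ^+ (m - j) %| p^`(j).
  move=> /dvdpP[q ->]; rewrite hornerM horner_exp hornerXsubC subrr expr0n.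
  by rewrite subn_eq0 leqNgt lt_jm mulr0.
elim: j lt_jm => [|j IH] lt_jm; first by rewrite subn0.
have /dvdpP[q Dq] := IH (ltnW lt_jm); rewrite derivnS Dq subnS.
have -> : (m - j = (m - j).-1.+1)%N by lia.
rewrite derivM deriv_exp /= derivXsubC mul1r dvdp_add //.
  by rewrite exprS mulrA dvdp_mull.
by rewrite mulrnAr -mulrnAl dvdp_mull.
Qed.

(** On polynomials of degree at most [m] this is [m!] times the classical apolarity pairing of
    binary forms. The order [m] is explicit because [A] may have smaller degree. *)
Definition apolar m A p : {poly F} :=
  \sum_(j < m.+1) (-1) ^+ j *: (p^`(j) * A^`(m - j)).

Fact apolar_is_linear m A : linear (apolar m A).
Proof.
move=> c p q; rewrite /apolar scaler_sumr -big_split; apply: eq_bigr => j _ /=.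
by rewrite linearP /= mulrDl scalerDr -scalerAl !scalerA mulrC.
Qed.

HB.instance Definition _ m A :=
  GRing.isLinear.Build F {poly F} {poly F} _ (apolar m A) (apolar_is_linear m A).

(** Swapping the arguments lets linearity in [A] be registered as an instance. *)
Definition apolarr m p A := apolar m A p.

Fact apolarr_is_linear m p : linear (apolarr m p).
Proof.
move=> c A B; rewrite /apolarr /apolar scaler_sumr -big_split; apply: eq_bigr => j _ /=.
by rewrite linearP /= mulrDr scalerDr -scalerAr !scalerA mulrC.
Qed.

HB.instance Definition _ m p :=
  GRing.isLinear.Build F {poly F} {poly F} _ (apolarr m p) (apolarr_is_linear m p).

(** The derivative of the [j]-th term is [u j - u j.+1], so the sum telescopes; [u 0] contains the
    derivative of order [m.+1] of [A], which is zero. *)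
Lemma deriv_apolar m A p : (size A <= m.+1)%N ->
  (apolar m A p)^`() = (-1) ^+ m *: (p^`(m.+1) * A).
Proof.
move=> sA.
pose u j := (-1) ^+ j *: (p^`(j) * A^`(m.+1 - j)).
have -> : (apolar m A p)^`() = \sum_(j < m.+1) (u j - u j.+1).
  rewrite /apolar raddf_sum; apply: eq_bigr => j _ /=.
  rewrite derivZ derivM -!derivnS /u subSS -subSn -1?ltnS // exprS mulN1r.
  by rewrite scaleNr opprK scalerDr addrC.
rewrite -(big_mkord xpredT (fun j => u j - u j.+1)).
rewrite -[LHS]opprK -sumrN (eq_bigr (fun j => u j.+1 - u j)) => [|j _]; last first.
  by rewrite opprB.
rewrite telescope_sumr // /u subn0 (derivn_poly0 sA) mulr0 scaler0 subr0 subnn.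
by rewrite exprS mulN1r scaleNr opprK.
Qed.

Lemma apolar_const m A p : (size A <= m.+1)%N -> (size p <= m.+1)%N ->
  apolar m A p = (apolar m A p).[0]%:P.
Proof.
move=> sA sp; rewrite horner_coef0; apply: deriv_eq0_const.
by rewrite deriv_apolar // (derivn_poly0 sp) mul0r scaler0.
Qed.

Lemma apolar_root m A p a : ('X - a%:P) ^+ m.+1 %| p -> root (apolar m A p) a.
Proof.
move=> dvd; rewrite /root /apolar horner_sum big1 // => j _.
by rewrite hornerZ hornerM (derivn_root _ dvd) // mul0r mulr0.
Qed.

Lemma apolar1 m A : apolar m A 1 = A^`(m).
Proof.
rewrite /apolar big_ord_recl [(m - _)%N]subn0 expr0 scale1r mul1r big1 ?addr0 // => j _.
by rewrite lift0 -polyC1 derivnC mul0r scaler0.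
Qed.

Lemma monic_derivn m A : A \is monic -> size A = m.+1 -> A^`(m) = (m`!%:R)%:P.
Proof.
move=> /monicP mA sA; rewrite [LHS]size1_polyC ?size_derivn ?sA ?subSnn //.
by rewrite coef_derivn addn0 ffactnn -[m]/(m.+1.-1) -sA -lead_coefE mA.
Qed.

Lemma size_apolar m A p n : (size A <= m.+1)%N -> (size p <= n)%N ->
  (size (apolar m A p) <= n)%N.
Proof.
move=> sA sp; rewrite (leq_trans (size_sum _ _ _)) //; apply/bigmax_leqP => j _.
rewrite (leq_trans (size_scale_leq _ _)) //.
have [le_pj|lt_jp] := leqP (size p) j; first by rewrite derivn_poly0 // mul0r size_poly0.
rewrite (leq_trans (size_polyMleq _ _)) // !size_derivn; have := ltn_ord j; lia.
Qed.

Lemma apolar_Xn_horner0 m A j : (j <= m)%N ->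
  (apolar m A 'X^j).[0] = (-1) ^+ j * (j`!%:R * (A`_(m - j) *+ (m - j)`!)).
Proof.
move=> le_jm; rewrite /apolar horner_sum.
have lt_jm : (j < m.+1)%N by [].
rewrite (bigD1 (Ordinal lt_jm)) //= big1 ?addr0 => [|i ne_ij].
  rewrite hornerZ hornerM derivnXn subnn expr0 ffactnn hornerMn hornerC.
  by rewrite horner_coef0 coef_derivn addn0 ffactnn.
rewrite hornerZ hornerM horner_coef0 coef_derivn coefXn addn0.
move/eqP: ne_ij; case: eqP => [e []|_ _]; first exact: val_inj.
by rewrite mul0rn mul0r mulr0.
Qed.

(** Pairing with the monomial of degree [m - i] isolates the coefficient [i] of [A], up to a nonzero
    factor. *)
Lemma apolar_nondegenerate m A : (size A <= m.+1)%N ->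
  (forall p, (size p <= m.+1)%N -> apolar m A p = 0) -> A = 0.
Proof.
move=> sA A0; apply/polyP=> i; rewrite coef0; case: (leqP i m) => [le_im|lt_mi].
  have := congr1 (fun q => q.[0]) (A0 'X^(m - i) _).
  rewrite size_polyXn ltnS leq_subr horner0 apolar_Xn_horner0 ?leq_subr //.
  move=> /(_ isT) /eqP; rewrite subKn //.
  rewrite mulf_eq0 signr_eq0 /= mulf_eq0 pnatr_eq0 -leqn0 leqNgt fact_gt0 /=.
  by rewrite mulrn_eq0 -leqn0 leqNgt fact_gt0 /= => /eqP.
by rewrite nth_default // (leq_trans sA).
Qed.

(* Both functionals take the value m! at 1, so they agree as soon as they have
   the same kernel. *)
Lemma apolar_kernel_inj m A B : A \is monic -> size A = m.+1 ->
    B \is monic -> size B = m.+1 ->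
    (forall p, (size p <= m.+1)%N -> apolar m A p = 0 -> apolar m B p = 0) ->
  A = B.
Proof.
move=> mA sA mB sB kerAB; apply/eqP; rewrite -subr_eq0; apply/eqP.
apply: (@apolar_nondegenerate m).
  by rewrite (leq_trans (size_polyD _ _)) // size_polyN sA sB maxnn.
move=> p sp; have -> : apolar m (A - B) p = apolar m A p - apolar m B p.
  exact: (raddfB (apolarr m p)).
pose c := (apolar m A p).[0] / m`!%:R.
have cE : c *: (m`!%:R)%:P = apolar m A p.
  rewrite (apolar_const _ sp) ?sA // -mul_polyC -polyCM; congr _%:P.
  by rewrite divfK // pnatr_eq0 -lt0n fact_gt0.
have /eqP : apolar m B (p - c *: 1) = 0.
  apply: kerAB.
    rewrite (leq_trans (size_polyD _ _)) // size_polyN geq_max sp /=.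
    by rewrite (leq_trans (size_scale_leq _ _)) // size_poly1.
  by rewrite linearB linearZ /= apolar1 monic_derivn // cE subrr.
rewrite linearB linearZ /= apolar1 (monic_derivn mB) // cE subr_eq0 => /eqP ->.
by rewrite subrr.
Qed.

(* Among the primitives of A B, the constant of integration is adjusted by
   adding a constant to p. *)
Lemma apolar_primitive m A B f : A \is monic -> size A = m.+1 -> f^`() = A * B ->
  exists p, (size p <= size B + m.+1)%N /\ apolar m A p = f.
Proof.
move=> mA sA df.
have [q dq] := exists_derivn ((-1) ^+ m *: B) m.+1.
pose c := (apolar m A q - f)`_0.
exists (q - (c / m`!%:R)%:P); split.
  rewrite (leq_trans (size_polyD _ _)) // size_polyN geq_max; apply/andP; split.
    by rewrite addnC -leq_subLR -size_derivn dq size_scale_leq.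
  by rewrite (leq_trans (size_polyC_leq1 _)) // addnS.
have Dc : apolar m A q - f = c%:P.
  apply: deriv_eq0_const; rewrite derivB deriv_apolar ?sA // dq df.
  by rewrite -scalerAl scalerA -expr2 sqrr_sign scale1r mulrC subrr.
rewrite linearB /= -[_%:P]mulr1 mul_polyC linearZ /= apolar1 monic_derivn //.
rewrite -mul_polyC -polyCM divfK ?pnatr_eq0 -?lt0n ?fact_gt0 //.
by rewrite -Dc opprB addrC subrK.
Qed.

End ApolarForm.

Lemma map_apolar (F F' : numFieldType) (s : {rmorphism F -> F'}) m (A p : {poly F}) :
  map_poly s (apolar m A p) = apolar m (map_poly s A) (map_poly s p).
Proof.
rewrite /apolar rmorph_sum; apply: eq_bigr => j _ /=.
by rewrite map_polyZ rmorphM /= !derivn_map rmorphXn rmorphN1.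
Qed.

(** * The Schubert problem in terms of polynomials *)

Section PolynomialInstance.
Variables (F : numFieldType) (V : vectType F) (n m : nat).
Variables (Psi : {linear V -> {poly F}}) (Finf : {vspace V}).
Hypotheses (lt_mn : (m.+1 < n)%N)
  (Psi_inj : forall v, Psi v = 0 -> v = 0)
  (size_Psi : forall v, (size (Psi v : {poly F}) <= n)%N)
  (Psi_surj : forall p : {poly F}, (size p <= n)%N -> exists v, Psi v = p)
  (mem_Finf : forall v, (v \in Finf) = (size (Psi v) <= m.+1)%N)
  (dim_Finf : \dim Finf = m.+1).
Variables (t : seq F) (f : {poly F}).
Hypotheses (t_uniq : uniq t) (t_size : size t = n.-1) (f_size : size f = n)
  (f_roots : forall z, root f z = (z \in t)).
Implicit Types (A B : {poly F}) (H : {vspace V}).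

Definition polynomial_instance H : Prop :=
  [/\ \dim H = m.+1, (m <= \dim (H :&: Finf))%N &
    forall a, a \in t ->
      exists v, [/\ v \in H, v != 0 & ('X - a%:P) ^+ m.+1 %| Psi v]].

(** Landing in row vectors, a finite-dimensional target, makes kernels, images and preimages
    available; [size_apolar] ensures that no coefficient is lost. *)
Definition apolar_map A : 'Hom(V, 'rV[F]_n) :=
  linfun (poly_rV \o apolar m A \o Psi).

Definition apolar_space A : {vspace V} :=
  (apolar_map A @^-1: <[poly_rV f]>)%VS.

Lemma poly_rV_inj (p q : {poly F}) : (size p <= n)%N -> (size q <= n)%N ->
  poly_rV p = poly_rV q :> 'rV_n -> p = q.
Proof. by move=> sp sq e; rewrite -(poly_rV_K sp) e poly_rV_K. Qed.

Lemma apolar_spaceP A v : (size A <= m.+1)%N ->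
  reflect (exists c, apolar m A (Psi v) = c *: f) (v \in apolar_space A).
Proof.
move=> sA; rewrite -memv_preim lfunE /=; apply: (iffP (vlineP _ _)) => -[c cE].
  exists c; apply: poly_rV_inj; rewrite ?size_apolar //.
    by rewrite (leq_trans (size_scale_leq _ _)) ?f_size.
  by rewrite linearZ.
by exists c; rewrite cE linearZ.
Qed.

Lemma mem_apolar_ker A v : (size A <= m.+1)%N ->
  (v \in lker (apolar_map A)) = (apolar m A (Psi v) == 0).
Proof.
move=> sA; rewrite memv_ker lfunE /=; apply/eqP/eqP => [|->]; last by rewrite linear0.
move=> e; apply: poly_rV_inj; rewrite ?size_apolar ?size_poly0 //.
by rewrite e linear0.
Qed.

(** Differentiating [apolar m A (Psi v) = 0] kills the derivative of order [m.+1] of [Psi v], since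
    [A] is nonzero. *)
Lemma apolar_ker_sub A : A != 0 -> (size A <= m.+1)%N ->
  (lker (apolar_map A) <= Finf)%VS.
Proof.
move=> A0 sA; apply/subvP => v; rewrite mem_apolar_ker // mem_Finf => /eqP e.
have := deriv_apolar (Psi v) sA; rewrite e linear0 => /esym/eqP.
by rewrite scaler_eq0 signr_eq0 mulf_eq0 (negPf A0) orbF derivn_eq0_size.
Qed.

Lemma f_neq0 : f != 0.
Proof. by rewrite -size_poly_gt0 f_size (leq_trans _ lt_mn). Qed.

Lemma const_eq_scale_f (a c : F) : a%:P = c *: f -> a = 0.
Proof.
have [->|c0 e] := eqVneq c 0.
  by rewrite scale0r => /eqP; rewrite polyC_eq0 => /eqP.
have := size_polyC_leq1 a; rewrite e size_scale // f_size => n1.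
by move: (leq_trans lt_mn n1).
Qed.

Lemma apolar_space_Finf A v : (size A <= m.+1)%N -> v \in Finf ->
  (v \in apolar_space A) = (apolar m A (Psi v) == 0).
Proof.
move=> sA; rewrite mem_Finf => sv; apply/apolar_spaceP/eqP => // [[c]|->]; last first.
  by exists 0; rewrite scale0r.
by rewrite apolar_const // => /const_eq_scale_f ->.
Qed.

(** Rank-nullity on [Finf]: there the form takes constant values, and the polynomial 1 gives a
    nonzero one. *)
Lemma dim_apolar_ker A : A \is monic -> size A = m.+1 ->
  \dim (lker (apolar_map A)) = m.
Proof.
move=> mA sA; have sA' : (size A <= m.+1)%N by rewrite sA.
have := limg_ker_dim (apolar_map A) Finf; rewrite dim_Finf.
have /capv_idPr -> := apolar_ker_sub (monic_neq0 mA) sA'.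
suff -> : (apolar_map A @: Finf)%VS = <[poly_rV 1]>%VS.
  rewrite dim_vline addnC; case: eqP => [/(congr1 rVpoly)|_ [] //].
  by rewrite poly_rV_K ?size_poly1 ?linear0 ?(leq_trans _ lt_mn) // => /eqP; rewrite oner_eq0.
apply/eqP; rewrite eqEsubv; apply/andP; split.
  apply/subvP => w /memv_imgP[v]; rewrite mem_Finf => sv ->.
  rewrite lfunE /= apolar_const // -[_%:P]mulr1 mul_polyC linearZ.
  exact/memvZ/memv_line.
have [v Dv] : exists v, Psi v = 1.
  by apply: Psi_surj; rewrite size_poly1 (leq_trans _ lt_mn).
have m0 : m`!%:R != 0 :> F by rewrite pnatr_eq0 -lt0n fact_gt0.
rewrite -memvE; apply/memv_imgP; exists (m`!%:R^-1 *: v).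
  by rewrite memvZ // mem_Finf Dv size_poly1.
rewrite linearZ /= lfunE /= Dv apolar1 monic_derivn // -[_%:P]mulr1 mul_polyC.
by rewrite linearZ scalerA mulVf // scale1r.
Qed.

Section Factorization.
Variables (A B : {poly F}).
Hypotheses (mA : A \is monic) (sA : size A = m.+1) (df : f^`() = A * B).

Let sA' : (size A <= m.+1)%N. Proof. by rewrite sA. Qed.

Lemma apolar_preimage_f : exists g, apolar m A (Psi g) = f.
Proof.
have [p [sp pE]] := apolar_primitive mA sA df.
have [g Dg] : exists g, Psi g = p; last by exists g; rewrite Dg.
have B0 : B != 0.
  apply: contraTneq (lt_mn) => B0; move/eqP: df.
  rewrite B0 mulr0 -derivn1 derivn_eq0_size f_size -leqNgt => /leq_trans; exact.
apply: Psi_surj; apply: leq_trans sp _.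
(* Comparing degrees in the factorization turns the bound [size B + m.+1] into exactly [n]. *)
have : size f^`(1) = size (A * B) by rewrite derivn1 df.
rewrite size_derivn f_size size_mul ?(monic_neq0 mA) // sA addSn /= subn1 => e.
by rewrite addnS addnC -e prednK // (leq_trans _ lt_mn).
Qed.

(** The kernel contributes [m], and the line of [f], which lies in the image, contributes one. *)
Lemma dim_apolar_space : \dim (apolar_space A) = m.+1.
Proof.
rewrite -(limg_ker_dim (apolar_map A) (apolar_space A)) /apolar_space.
have [g Dg] := apolar_preimage_f.
rewrite lpreimK; last first.
  by rewrite -memvE; apply/memv_imgP; exists g; rewrite ?memvf // lfunE /= Dg.
have /capv_idPr -> : (lker (apolar_map A) <= apolar_space A)%VS.
  apply/subvP => v; rewrite mem_apolar_ker // => /eqP e.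
  by apply/apolar_spaceP => //; exists 0; rewrite scale0r.
rewrite dim_apolar_ker // dim_vline -[RHS]addn1; congr addn.
case: eqP => // e; case/eqP: f_neq0.
by apply: poly_rV_inj; rewrite ?f_size ?size_poly0 // e linear0.
Qed.

(* The witness at a is the Taylor remainder of a g with apolar g = f. *)
Lemma apolar_space_instance : polynomial_instance (apolar_space A).
Proof.
split; first exact: dim_apolar_space.
  rewrite -(dim_apolar_ker mA sA); apply/dimvS/subvP => v vk.
  have vF := subvP (apolar_ker_sub (monic_neq0 mA) sA') _ vk.
  by rewrite memv_cap vF andbT apolar_space_Finf // -mem_apolar_ker.
move=> a ta; have [g Dg] := apolar_preimage_f.
set d : {poly F} := ('X - a%:P) ^+ m.+1.
have szd : size d = m.+2 by rewrite size_exp_XsubC.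
have d0 : d != 0 by rewrite -size_poly_gt0 szd.
have sr : (size (Psi g %% d)%R <= m.+1)%N by rewrite -ltnS -szd ltn_modp.
have [r Dr] : exists r, Psi r = Psi g %% d.
  by apply: Psi_surj; apply: leq_trans sr (ltnW lt_mn).
have dvd : d %| Psi (g - r).
  by rewrite linearB /= Dr {1}(divp_eq (Psi g) d) addrK dvdp_mull.
(* The remainder has degree at most [m], so its image is constant. It vanishes at [a] because [f]
   and the image of the multiple [Psi (g - r)] both do. *)
have r0 : apolar m A (Psi r) = 0.
  have rC := apolar_const sA' sr.
  have : (apolar m A (Psi r)).[a] = 0.
    have -> : r = g - (g - r) by rewrite opprB addrC subrK.
    rewrite linearB linearB /= Dg hornerD hornerN.
    rewrite (eqP (apolar_root A dvd)) subr0; apply/eqP.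
    by have := f_roots a; rewrite ta.
  by rewrite Dr rC hornerC => e; rewrite e polyC0.
have gr : apolar m A (Psi (g - r)) = f by rewrite linearB linearB /= Dg r0 subr0.
exists (g - r); split => //.
  by apply/apolar_spaceP => //; exists 1; rewrite scale1r.
by apply: contra_neq f_neq0 => e; rewrite -gr e !linear0.
Qed.

End Factorization.

(** Each basis vector of [U] imposes one linear equation on the [m.+1] coefficients of [A]; at most
    [m] equations leave a nonzero solution, a row killed by [M]. *)
Lemma exists_apolar (U : {vspace V}) : (\dim U <= m)%N -> (U <= Finf)%VS ->
  exists A, [/\ A != 0, (size A <= m.+1)%N &
                forall u, u \in U -> apolar m A (Psi u) = 0].
Proof.
move=> dU UF; pose e j := Psi (vbasis U)`_j.
pose M := \matrix_(i < m.+1, j < \dim U) (apolar m 'X^i (e j)).[0].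
have : kermx M != 0.
  rewrite kermx_eq0; apply: contraL dU => /eqP rM.
  by rewrite -ltnNge -rM rank_leq_col.
case/rowV0Pn => a /sub_kermxP aM a0; pose A := rVpoly a.
have sA : (size A <= m.+1)%N by apply: size_poly.
have A0 : A != 0 by apply: contra_neq a0 => e0; rewrite -[a]rVpolyK -/A e0 linear0.
exists A; split=> // u uU; rewrite (coord_vbasis uU) !linear_sum big1 // => j _.
rewrite !linearZ /= -/(e j).
have se : (size (e j) <= m.+1)%N.
  rewrite -mem_Finf; apply: (subvP UF); apply: vbasis_mem.
  by apply: mem_nth; rewrite size_tuple.
rewrite apolar_const //; suff -> : (apolar m A (e j)).[0] = 0 by rewrite scaler0.
have := congr1 (fun w : 'rV_(\dim U) => w 0 j) aM; rewrite !mxE => aMj.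
have -> : A = \sum_(i < m.+1) a 0 i *: 'X^i.
  rewrite /A /rVpoly poly_def; apply: eq_bigr => i _.
  by rewrite insubT // => lt_i; congr (a _ _ *: _); apply: val_inj.
rewrite -[RHS]aMj -/(apolarr m (e j) _) linear_sum horner_sum; apply: eq_bigr => i _.
by rewrite mxE linearZ hornerZ.
Qed.

(** Both [p] and [f] have degree at most [n.-1] and vanish at [n.-1] distinct points, so both are
    nonzero multiples of one product of linear factors. *)
Lemma root_multiple (p : {poly F}) : p != 0 -> (size p <= n)%N ->
  {in t, forall a, root p a} -> exists2 c, c != 0 & p = c *: f.
Proof.
move=> p0 sp pt; have n0 : (0 < n)%N by apply: leq_trans lt_mn.
have key (q : {poly F}) : q != 0 -> (size q <= n)%N -> {in t, forall a, root q a} ->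
    q = lead_coef q *: \prod_(a <- t) ('X - a%:P).
  move=> q0 sq qt; have allq : all (root q) t by apply/allP.
  apply: all_roots_prod_XsubC => //; last by rewrite uniq_rootsE.
  apply/eqP; rewrite eqn_leq t_size prednK // sq /= -(prednK n0) -t_size.
  exact: max_poly_roots.
have ft : f = lead_coef f *: \prod_(a <- t) ('X - a%:P).
  by apply: key; rewrite ?f_neq0 ?f_size // => a ta; rewrite f_roots.
have lf : lead_coef f != 0 by rewrite lead_coef_eq0 f_neq0.
exists (lead_coef p / lead_coef f); first by rewrite mulf_neq0 ?invr_eq0 // lead_coef_eq0.
by rewrite {2}ft scalerA divfK //; apply: key.
Qed.

Lemma polynomial_instance_factor H : polynomial_instance H ->
  exists A B, [/\ A \is monic, size A = m.+1, f^`() = A * B & H = apolar_space A].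
Proof.
case=> dH dHF Ht; set U := (H :&: Finf)%VS.
have n0 : (0 < n.-1)%N by rewrite -subn1 subn_gt0 (leq_trans _ lt_mn).
have n0' : (1 < n)%N by apply: leq_trans lt_mn.
have t0 : t`_0 \in t by rewrite mem_nth // t_size.
(* A nonzero multiple of [('X - a%:P) ^+ m.+1] has degree above [m]. *)
have notF v a : v != 0 -> ('X - a%:P) ^+ m.+1 %| Psi v -> v \notin Finf.
  move=> v0 dvd; rewrite mem_Finf -ltnNge.
  have := dvdp_leq _ dvd; rewrite size_exp_XsubC; apply.
  by apply: contra_neq v0; exact: Psi_inj.
have [g [gH g0 gd]] := Ht _ t0.
have gF := notF _ _ g0 gd.
(* Since [g] lies in [H] but off [Finf], the intersection [U] is a proper subspace of [H]. *)
have dU : \dim U = m.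
  apply/eqP; rewrite eqn_leq dHF andbT -ltnS -dH ltn_neqAle dimvS ?capvSl // andbT.
  apply/negP=> /eqP e; move: gF; suff -> : g \in Finf by [].
  have /eqP UH : U == H by rewrite eqEdim capvSl e /=.
  by move: gH; rewrite -{1}UH memv_cap => /andP[].
have HU v : v \in H -> exists c u, u \in U /\ v = c *: g + u.
  have -> : H = (<[g]> + U)%VS.
    apply/eqP; rewrite eq_sym eqEdim subv_add -memvE gH capvSl /=.
    rewrite dimv_disjoint_sum ?dU ?dH ?dim_vline ?g0 //.
    apply/eqP; rewrite -subv0; apply/subvP => w; rewrite memv_cap => /andP[/vlineP[c ->]].
    rewrite memv_cap => /andP[_]; have [->|c0] := eqVneq c 0; first by rewrite scale0r !mem0v.
    by move/(memvZ c^-1); rewrite scalerA mulVf // scale1r (negPf gF).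
  by case/memv_addP=> w /vlineP[c ->] [u uU ->]; exists c, u.
have [||A0 [A00 sA0 A0U]] := @exists_apolar U; rewrite ?dU ?capvSr //.
pose G := apolar m A0 (Psi g).
have AH c u : u \in U -> apolar m A0 (Psi (c *: g + u)) = c *: G.
  by move=> uU; rewrite linearP linearP /= (A0U _ uU) addr0.
have dG : G^`() = (-1) ^+ m *: ((Psi g)^`(m.+1) * A0) by apply: deriv_apolar.
have G0 : G != 0.
  apply: contraNneq gF => G0; move/eqP: dG; rewrite G0 linear0 eq_sym.
  by rewrite scaler_eq0 signr_eq0 mulf_eq0 (negPf A00) orbF derivn_eq0_size mem_Finf.
(* The witness at [a] has the form [c *: g + u] with [c] nonzero, and [u] has zero image, so the
   root of its image at [a] is a root of [G]. *)
have [|||c c0 Gc] := @root_multiple G => //; first by rewrite size_apolar.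
  move=> a ta; have [v [vH v0 vd]] := Ht a ta.
  have [c [u [uU Dv]]] := HU v vH.
  have c0 : c != 0.
    apply: contra_neqT (v0) => /negPn/eqP c0; move: (notF _ _ v0 vd).
    by rewrite Dv c0 scale0r add0r; move: uU; rewrite memv_cap => /andP[_ ->].
  have := apolar_root A0 vd; rewrite Dv AH // rootZ //.
pose l := lead_coef A0; have l0 : l != 0 by rewrite lead_coef_eq0.
pose B0 : {poly F} := (-1) ^+ m *: (Psi g)^`(m.+1).
have df : c *: f^`() = A0 * B0.
  by rewrite -derivZ -Gc dG /B0 -scalerAr mulrC.
have B00 : B0 != 0.
  by rewrite scaler_eq0 signr_eq0 derivn_eq0_size -mem_Finf.
have sizes : size (A0 * B0) = n.-1.
  by rewrite -df size_scale // -derivn1 size_derivn f_size subn1.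
have sB0 : (size B0 <= n - m.+1)%N.
  by rewrite size_scale ?signr_eq0 // size_derivn leq_sub2r.
(* The product has size [n.-1] and [B0] has size at most [n - m.+1], which forces [A0] to have full
   degree [m]. *)
have sA : size A0 = m.+1.
  apply/eqP; rewrite eqn_leq sA0 /= -(leq_add2r (size B0)).
  rewrite (leq_trans (leq_add (leqnn _) sB0)) // subnKC ?(ltnW lt_mn) //.
  by rewrite -(prednK (ltnW n0')) -sizes size_mul // prednK // addn_gt0 size_poly_gt0 A00.
have mA : l^-1 *: A0 \is monic by rewrite monicE lead_coefZ mulVf.
have sA1 : size (l^-1 *: A0) = m.+1 by rewrite size_scale ?invr_eq0.
have df1 : f^`() = (l^-1 *: A0) * ((c^-1 * l) *: B0).
  rewrite -scalerAl -scalerAr scalerA -df scalerA.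
  by rewrite (mulrCA l^-1) mulVf // mulr1 mulVf // scale1r.
exists (l^-1 *: A0), ((c^-1 * l) *: B0); split => //.
apply/eqP; rewrite eqEdim dH (dim_apolar_space mA sA1 df1) leqnn andbT.
apply/subvP => v /HU[c1 [u [uU ->]]]; apply/apolar_spaceP; first by rewrite sA1.
exists (l^-1 * (c1 * c)).
rewrite -/(apolarr _ _ _) linearZ /= /apolarr AH // Gc !scalerA; congr (_ *: f).
by rewrite !mulrA.
Qed.

End PolynomialInstance.

(** * Osculating flags as spaces of polynomials *)

Lemma derivn_exp_subX (K : comNzRingType) (c : K) N r :
  (((c%:P - 'X) ^+ N)^`(r) =
    (-1) ^+ r *: (c%:P - 'X) ^+ (N - r) *+ N ^_ r)%R.
Proof.
elim: r => [|r IH]; first by rewrite derivn0 subn0 ffactn0 expr0 scale1r.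
rewrite derivnS IH derivMn derivZ deriv_exp derivB derivC derivX sub0r mulN1r.
rewrite -subnS -scalerMnr -mulrnA mulnC -ffactnSr scalerN -scaleNr.
by rewrite -[- _]mulN1r -exprS.
Qed.

Lemma derivative_flagS (R : rcfType) n (c : 'I_n -> {poly R[i]}) a j :
  derivative_flag c a j.+1 =
  (derivative_flag c a j + <[\row_l (c l)^`(j).[a]]>)%VS.
Proof.
by rewrite /derivative_flag -(addn1 j) iotaD map_cat span_cat add0n /= span_seq1.
Qed.

Lemma derivative_flag0 (R : rcfType) n (c : 'I_n -> {poly R[i]}) a :
  derivative_flag c a 0 = 0%VS.
Proof. by rewrite /derivative_flag /= span_nil. Qed.

Section OsculatingPolynomial.
Variables (R : rcfType) (n : nat).
Local Notation C := (R[i]).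
Variables (c : 'I_n -> {poly C}).
Hypotheses (n_gt0 : (0 < n)%N) (size_c : forall j, (size (c j) <= n)%N).

Definition coef_matrix : 'M[C]_n := \matrix_(i, j) (c j)`_i.

Hypothesis coef_unit : coef_matrix \in unitmx.

(** The coefficient of [a ^+ i *: 'X^(n.-1 - i)] in the expansion of [('X - a%:P) ^+ n.-1]. *)
Definition osc_coef (i : nat) : C := (-1) ^+ i * 'C(n.-1, i)%:R.

Lemma osc_coef_neq0 (i : nat) : (i < n)%N -> osc_coef i != 0.
Proof.
move=> lt_in; rewrite mulf_neq0 ?signr_eq0 // pnatr_eq0 -lt0n bin_gt0.
by rewrite -ltnS prednK.
Qed.

(* The linear isomorphism onto the polynomials of degree less than n which
   maps c(a) to (X - a)^(n-1). *)
Definition osc_poly (v : 'rV[C]_n) : {poly C} :=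
  \sum_(i < n) (osc_coef i * (v *m invmx coef_matrix) 0 i) *: 'X^(n.-1 - i).

Fact osc_poly_is_linear : linear osc_poly.
Proof.
move=> a u v; rewrite /osc_poly scaler_sumr -big_split; apply: eq_bigr => i _ /=.
by rewrite mulmxDl -scalemxAl !mxE mulrDr scalerDl mulrCA scalerA.
Qed.

HB.instance Definition _ :=
  GRing.isLinear.Build C 'rV[C]_n {poly C} _ osc_poly osc_poly_is_linear.

Lemma osc_polyM (w : 'rV[C]_n) :
  osc_poly (w *m coef_matrix) =
  \sum_(i < n) (osc_coef i * w 0 i) *: 'X^(n.-1 - i).
Proof. by rewrite /osc_poly mulmxK. Qed.

Lemma coef_osc_poly v (i : 'I_n) :
  (osc_poly v)`_(n.-1 - i) = osc_coef i * (v *m invmx coef_matrix) 0 i.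
Proof.
rewrite /osc_poly coef_sum (bigD1 i) //= coefZ coefXn eqxx mulr1 big1 ?addr0 //.
move=> j ne_ji; rewrite coefZ coefXn; case: eqP => [e|]; last by rewrite mulr0.
by case/eqP: ne_ji; apply: val_inj => /=; have := ltn_ord i; have := ltn_ord j; lia.
Qed.

Lemma osc_poly_inj v : osc_poly v = 0 -> v = 0.
Proof.
move=> v0; rewrite -(mulmxKV coef_unit v); set w := v *m _.
suff -> : w = 0 by rewrite mul0mx.
apply/rowP=> i; rewrite [RHS]mxE; apply/eqP; have := coef_osc_poly v i.
rewrite v0 coef0 -/w => /esym/eqP.
by rewrite mulf_eq0 (negPf (osc_coef_neq0 (ltn_ord i))).
Qed.

Lemma size_osc_poly v : (size (osc_poly v) <= n)%N.
Proof.
rewrite (leq_trans (size_sum _ _ _)) //; apply/bigmax_leqP => i _.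
rewrite (leq_trans (size_scale_leq _ _)) // size_polyXn.
by rewrite -[X in (_ <= X)%N](prednK n_gt0) ltnS leq_subr.
Qed.

Lemma osc_poly_surj (p : {poly C}) : (size p <= n)%N -> exists v, osc_poly v = p.
Proof.
move=> sp; exists ((\row_i (p`_(n.-1 - i) / osc_coef i)) *m coef_matrix).
rewrite osc_polyM (reindex_inj rev_ord_inj) /=.
have {2}-> : p = \poly_(i < n) p`_i.
  apply/polyP=> i; rewrite coef_poly; case: ltnP => // le_ni.
  by rewrite nth_default // (leq_trans sp).
rewrite poly_def; apply: eq_bigr => i _; rewrite mxE mulrC divfK.
  by have -> : (n.-1 - (n - i.+1) = i)%N by have := ltn_ord i; lia.
by apply: osc_coef_neq0; rewrite /= ltn_subrL n_gt0.
Qed.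

(** This is the correspondence of c(a) with (X - a)^(n-1), differentiated [r] times in [a]. *)
Lemma osc_poly_derivn (a : C) r : (r < n)%N ->
  osc_poly (\row_j (c j)^`(r).[a]) =
  ((-1) ^+ r * (n.-1 ^_ r)%:R) *: ('X - a%:P) ^+ (n.-1 - r).
Proof.
(* In [P] the outer variable is the curve parameter, and the inner one is the variable of the
   resulting polynomial. *)
move=> lt_rn; pose N := n.-1; pose P : {poly {poly C}} := ('X%:P - 'X) ^+ N.
have -> : \row_j (c j)^`(r).[a] =
    (\row_(i < n) ('X^i : {poly C})^`(r).[a]) *m coef_matrix.
  apply/rowP=> j; rewrite !mxE.
  have {1}-> : c j = \sum_(i < n) (c j)`_i *: 'X^i.
    rewrite -poly_def; apply/polyP=> i; rewrite coef_poly; case: ltnP => // le_ni.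
    by rewrite nth_default // (leq_trans (size_c j)).
  rewrite linear_sum horner_sum; apply: eq_bigr => i _.
  by rewrite linearZ hornerZ !mxE mulrC.
have <- : P^`(r).[a%:P] =
    ((-1) ^+ r * (N ^_ r)%:R) *: ('X - a%:P) ^+ (N - r).
  rewrite derivn_exp_subX hornerMn hornerZ horner_exp hornerD hornerN hornerX hornerC.
  by rewrite -mul_polyC rmorphM rmorphXn rmorphN1 rmorph_nat mulr_natr mulrnAl.
rewrite osc_polyM /P exprBn linear_sum horner_sum /N prednK //.
apply: eq_bigr => i _; rewrite mxE.
have -> : (-1) ^+ i * 'X%:P ^+ (n.-1 - i) * 'X^i =
    ((-1) ^+ i * 'X^(n.-1 - i)) *: 'X^i :> {poly {poly C}}.
  by rewrite -mul_polyC rmorphM !rmorphXn rmorphN1.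
rewrite /= derivnMn derivnZ hornerMn hornerZ !derivnXn !hornerMn !hornerXn.
rewrite -rmorphXn /= -mul_polyC /osc_coef !rmorphM rmorphXn rmorphN1 rmorph_nat.
rewrite rmorphMn /= -[RHS]mulr_natr -!mulrA; congr (_ * _).
by rewrite mulrA [LHS]mulrC [in LHS](mulrC (_%:R)).
Qed.

(** Induction on [j]: the vector added to the flag is a nonzero multiple of (X - a)^(n-1-j). For
    [j = 0], a multiple of (X - a)^n of degree less than [n] is zero. *)
Lemma mem_derivative_flag a j v : (j <= n)%N ->
  (v \in derivative_flag c a j) = (('X - a%:P) ^+ (n - j) %| osc_poly v).
Proof.
elim: j v => [|j IH] v lt_jn.
  rewrite derivative_flag0 memv0 subn0; apply/eqP/idP => [->|dvd].
    by rewrite linear0 dvdp0.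
  apply: osc_poly_inj; apply/eqP; apply: contraLR (size_osc_poly v) => v0.
  by rewrite -ltnNge; have := dvdp_leq v0 dvd; rewrite size_exp_XsubC.
have Dj : (n - j = (n - j.+1).+1)%N by rewrite subnSK.
rewrite derivative_flagS; set e := \row_l _.
pose k : C := (-1) ^+ j * (n.-1 ^_ j)%:R.
have k0 : k != 0.
  rewrite mulf_neq0 ?signr_eq0 // pnatr_eq0 -lt0n ffact_gt0.
  by rewrite -ltnS prednK.
have eE : osc_poly e = k *: ('X - a%:P) ^+ (n - j.+1).
  by rewrite osc_poly_derivn //; congr (_ *: _ ^+ _); lia.
apply/memv_addP/idP => [[u]|].
  rewrite (IH _ (ltnW lt_jn)) Dj => ud [_ /vlineP[b ->] ->].
  rewrite linearD linearZ /= eE scalerA dvdp_add //.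
    by apply: dvdp_trans ud; rewrite exprS dvdp_mulIr.
  by rewrite -mul_polyC dvdp_mulIr.
(* This [b] cancels the value of the cofactor at [a], which yields one more factor X - a. *)
case/dvdpP=> q Dq; pose b := q.[a] / k.
exists (v - b *: e); last by exists (b *: e); rewrite ?memvZ ?memv_line // subrK.
rewrite (IH _ (ltnW lt_jn)) linearB linearZ /= Dq eE scalerA divfK // -mul_polyC -mulrBl.
rewrite Dj exprS dvdp_mul2r ?expf_neq0 ?polyXsubC_eq0 // dvdp_XsubCl.
by rewrite /root !hornerE subrr.
Qed.

(** After reversal of coefficients, the [j]-th derivative at 0 picks out the coefficients of degree
    [n.-1 - j]; the corresponding polynomial is a nonzero multiple of ['X^j]. *)
Lemma mem_derivative_flag_infty j v : (j <= n)%N ->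
  (v \in derivative_flag (fun l => \poly_(i < n) (c l)`_(n.-1 - i)) 0 j) =
  (size (osc_poly v) <= j)%N.
Proof.
elim: j v => [|j IH] v lt_jn.
  rewrite derivative_flag0 memv0 size_poly_leq0; apply/eqP/eqP => [->|].
    by rewrite linear0.
  exact: osc_poly_inj.
rewrite derivative_flagS; set e := \row_l _.
have lt_j' : (n.-1 - j < n)%N by lia.
pose k : C := osc_coef (n.-1 - j) * j`!%:R.
have k0 : k != 0.
  by rewrite mulf_neq0 ?osc_coef_neq0 // pnatr_eq0 -lt0n fact_gt0.
have eE : osc_poly e = k *: 'X^j.
  have -> : e = (j`!%:R *: delta_mx 0 (Ordinal lt_j')) *m coef_matrix.
    apply/rowP=> l; rewrite -scalemxAl -rowE !mxE horner_coef0 coef_derivn.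
    by rewrite addn0 ffactnn coef_poly lt_jn mulr_natl.
  rewrite osc_polyM (bigD1 (Ordinal lt_j')) //= big1 ?addr0 => [|i ne_ij].
    rewrite !mxE !eqxx mulr1; congr (_ *: 'X^_); lia.
  by rewrite !mxE (negPf ne_ij) andbF !mulr0 scale0r.
apply/memv_addP/idP => [[u]|sv].
  rewrite (IH _ (ltnW lt_jn)) => su [_ /vlineP[b ->] ->].
  rewrite linearD linearZ /= eE (leq_trans (size_polyD _ _)) // geq_max.
  rewrite (leq_trans su) //= scalerA (leq_trans (size_scale_leq _ _)) //.
  by rewrite size_polyXn.
pose b := (osc_poly v)`_j / k.
exists (v - b *: e); last by exists (b *: e); rewrite ?memvZ ?memv_line // subrK.
rewrite (IH _ (ltnW lt_jn)) linearB linearZ /= eE scalerA divfK //.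
apply/leq_sizeP => i le_ji; rewrite coefB coefZ coefXn.
have [->|ne_ij] := eqVneq i j; first by rewrite mulr1 subrr.
rewrite mulr0 subr0 nth_default //; move/eqP: ne_ij => ne_ij.
by rewrite (leq_trans sv) // ltn_neqAle le_ji andbT eq_sym; apply/eqP.
Qed.

End OsculatingPolynomial.

(** The [n] derivatives spanning the full space are free, and so is every initial segment of
    them. *)
Lemma dim_derivative_flag (R : rcfType) (n : nat) (c : 'I_n -> {poly R[i]}) a j :
  derivative_flag c a n = fullv -> (j <= n)%N -> \dim (derivative_flag c a j) = j.
Proof.
move=> full le_jn; pose e m : 'rV[R[i]]_n := \row_l (c l)^`(m).[a].
have : free [seq e i | i <- iota 0 n].
  by rewrite /free -/(derivative_flag c a n) full dimvf size_map size_iota dim_matrix mul1r.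
have -> : iota 0 n = iota 0 j ++ iota j (n - j) by rewrite -iotaD subnKC.
rewrite map_cat => /catl_free /eqP.
by rewrite size_map size_iota.
Qed.

Lemma osc_poly_conj (R : rcfType) n (c : 'I_n -> {poly R[i]}) v :
    map_mx (@conjc R) (coef_matrix c) = coef_matrix c ->
  osc_poly c (map_mx (@conjc R) v) = map_poly (@conjc R) (osc_poly c v).
Proof.
move=> Gr; rewrite /osc_poly raddf_sum; apply: eq_bigr => i _ /=.
rewrite map_polyZ map_polyXn rmorphM /=; congr (_ * _ *: _).
  by rewrite /osc_coef rmorphM rmorphXn rmorphN1 rmorph_nat.
by rewrite -{1}Gr -map_invmx -map_mxM mxE.
Qed.

(** * Translation of the osculating instance into polynomials *)

Lemma dimv_cap_sub (K : fieldType) (V : vectType K) (U W E : {vspace V}) :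
  (U <= E)%VS -> (W <= E)%VS ->
  (\dim U + \dim W <= \dim E + \dim (U :&: W))%N.
Proof.
move=> UE WE; rewrite -dimv_sum_cap leq_add2r dimvS //.
by rewrite subv_add UE.
Qed.

Section OsculatingInstance.
Variables (R : rcfType) (n m : nat).
Hypothesis lt_mn : (m.+1 < n)%N.
Variables (gamma : n.-tuple {poly_n R}).
Hypothesis hgamma : rational_normal_curve gamma.
Local Notation c := (affine_component gamma).
Local Notation Psi := (osc_poly c).
Local Notation Finf := (osculating_flag_infty gamma).

Lemma size_affine_component j : (size (c j) <= n)%N.
Proof. by rewrite size_map_poly size_npoly. Qed.

Lemma coef_matrix_real : map_mx (@conjc R) (coef_matrix c) = coef_matrix c.
Proof. by apply/matrixP=> i j; rewrite !mxE coef_map /= oppr0. Qed.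

(** A real linear relation between the columns is a relation between the components of [gamma],
    which form a basis. *)
Lemma coef_matrix_unit : coef_matrix c \in unitmx.
Proof.
pose G := \matrix_(i < n, j < n) (tnth gamma j : {poly R})`_i.
have -> : coef_matrix c = map_mx (real_complex R) G.
  by apply/matrixP=> i j; rewrite !mxE coef_map.
rewrite map_unitmx -unitmx_tr -row_free_unit; apply: inj_row_free => v vG.
have /freeP fg := basis_free hgamma.
apply/rowP=> j; rewrite mxE; apply: (fg (v 0)).
apply: val_inj; rewrite raddf_sum /=; apply/polyP=> i; rewrite coef_sum coef0.
have [lt_in|le_ni] := ltnP i n.
  have := congr1 (fun w : 'rV_n => w 0 (Ordinal lt_in)) vG; rewrite !mxE => vGi.
  rewrite -[RHS]vGi.
  by apply: eq_bigr => l _; rewrite !mxE coefZ (tnth_nth 0).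
by apply: big1 => l _; rewrite coefZ nth_default ?mulr0 // (leq_trans (size_npoly _)).
Qed.

Let n_gt0 : (0 < n)%N. Proof. exact: leq_trans lt_mn. Qed.

Lemma mem_osculating_flag a j v : (j <= n)%N ->
  (v \in osculating_flag gamma a j) = (('X - a%:P) ^+ (n - j) %| Psi v).
Proof.
exact: (mem_derivative_flag n_gt0 size_affine_component coef_matrix_unit).
Qed.

Lemma mem_osculating_flag_infty j v : (j <= n)%N ->
  (v \in Finf j) = (size (Psi v) <= j)%N.
Proof. exact: (mem_derivative_flag_infty n_gt0 coef_matrix_unit). Qed.

Lemma dim_osculating_flag a j : (j <= n)%N -> \dim (osculating_flag gamma a j) = j.
Proof.
apply: dim_derivative_flag; apply/vspaceP => v.
by rewrite memvf (mem_osculating_flag a v (leqnn n)) subnn expr0 dvd1p.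
Qed.

Lemma dim_osculating_flag_infty j : (j <= n)%N -> \dim (Finf j) = j.
Proof.
apply: dim_derivative_flag; apply/vspaceP => v.
by rewrite memvf (mem_osculating_flag_infty v (leqnn n)) size_osc_poly.
Qed.

Lemma osculating_instanceP (t : n.-1.-tuple R[i]) H :
  osculating_instance gamma m.+1 t H <->
  polynomial_instance m Psi (Finf m.+1) t H.
Proof.
have so : size (omega_cond n m.+1) = m.+1 by rewrite size_rcons size_iota.
have nm : (n - (n - m.+1) = m.+1)%N by rewrite subKn // ltnW.
split.
  case=> -[dH omH] boxH; move: dH omH boxH; rewrite /Gr /= so => dH omH boxH.
  split=> // [|a /tnthP[i ->]].
    (* For [m = 0] the bound is trivial; otherwise it is the condition of index [m'], whose entry in
       omega is [m.+1]. *)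
    case: (m) omH => [//|m' /(_ m' (ltnW (ltnSn _)))].
    by rewrite nth_rcons size_iota ltnSn nth_iota // add2n.
  have [_ /= /(_ 0%N isT)] := boxH i; rewrite /= => Hi.
  set U := (_ :&: _)%VS in Hi; have U0 : U != 0%VS by rewrite -dimv_eq0 -lt0n.
  exists (vpick U); have := memv_pick U; rewrite memv_cap => /andP[-> vF].
  rewrite vpick0 U0; split=> //; move: vF.
  by rewrite mem_osculating_flag ?leq_subr // nm.
case=> dH dHF Ht; split=> [|i]; split; rewrite /Gr /= ?so ?size_iota //.
  move=> i lt_im; rewrite /omega_cond nth_rcons size_iota /=.
  case: (ltnP i m) => [lt_i|le_mi].
    rewrite nth_iota // add2n.
    (* [H] meets [Finf m.+1] in codimension at most one there, so intersecting with [Finf i.+2]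
       loses at most one dimension. *)
    have UE : (H :&: Finf m.+1 <= Finf m.+1)%VS by apply: capvSr.
    have lt_in : (i.+2 <= n)%N by apply: leq_trans (ltnW lt_mn).
    have WE : (Finf i.+2 <= Finf m.+1)%VS.
      apply/subvP => v; rewrite !mem_osculating_flag_infty // ?(ltnW lt_mn) //.
      by move/leq_trans; apply.
    have := dimv_cap_sub UE WE.
    rewrite !dim_osculating_flag_infty ?(ltnW lt_mn) //.
    have : (\dim (H :&: Finf m.+1 :&: Finf i.+2) <= \dim (H :&: Finf i.+2))%N.
      by rewrite dimvS // capvS // capvSl.
    move: dHF; set x := \dim _; set y := \dim _; set z := \dim _; lia.
  have -> : i = m by apply/eqP; rewrite eqn_leq le_mi -ltnS lt_im.
  rewrite eqxx; have /capv_idPl -> : (H <= Finf n)%VS.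
    by apply/subvP => v _; rewrite mem_osculating_flag_infty // size_osc_poly.
  by rewrite dH.
case=> [_|j lt_jm].
  have [v [vH v0 vd]] := Ht _ (mem_tnth i t); rewrite lt0n dimv_eq0 /=.
  apply: contraNneq v0 => HF0; rewrite -memv0 -HF0 memv_cap vH /=.
  by rewrite mem_osculating_flag ?leq_subr // nm.
rewrite /= nth_iota //; set l := (_ + _)%N; have le_ln : (l <= n)%N by rewrite /l; lia.
(* As [l] is [n - m.+1 + 2 + j], every space of dimension [m.+1] meets this flag member in dimension
   at least [j.+2]. *)
have := dimv_cap_sub (subvf H) (subvf (osculating_flag gamma (tnth t i) l)).
rewrite dimvf dim_matrix mul1r dim_osculating_flag // dH.
set x := \dim _; rewrite /l; lia.
Qed.

End OsculatingInstance.

(** * Real polynomials and finiteness of divisors *)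

Lemma conj_poly_real (R : rcfType) (p : {poly R[i]}) :
  map_poly (@conjc R) p = p -> exists q, p = map_poly (real_complex R) q.
Proof.
move=> pr; exists (map_poly (@complex.Re R) p); apply/polyP=> i.
rewrite coef_map coef_map_id0 //=.
have := congr1 (fun q : {poly R[i]} => q`_i) pr; rewrite coef_map /=.
case: (p`_i) => a b [] /eqP; rewrite eq_sym -subr_eq0 opprK -mulr2n mulrn_eq0 /=.
by move=> /eqP ->.
Qed.

Lemma map_real_conj (R : rcfType) (q : {poly R}) :
  map_poly (@conjc R) (map_poly (real_complex R) q) = map_poly (real_complex R) q.
Proof. by apply/polyP=> i; rewrite !coef_map /= oppr0. Qed.

(** Here [g] splits, and a monic divisor is a subproduct of its linear factors, named by a boolean
    mask on the list of roots. *)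
Lemma finite_monic_divisors (K : closedFieldType) (g : {poly K}) :
  g != 0 -> finite_set [set A : {poly K} | A \is monic /\ A %| g].
Proof.
move=> g0; have [r gE] := closed_field_poly_normal g.
pose P (b : (size r).-tuple bool) := \prod_(z <- mask b r) ('X - z%:P).
apply: (@sub_finite_set _ _ (P @` setT)); last exact/finite_image/finite_finset.
move=> A [mA]; rewrite gE dvdpZr ?lead_coef_eq0 // => /dvdp_prod_XsubC[b].
have /subseqP[b' sb' ->] := mask_subseq b r.
rewrite eqp_monic ?monic_prod_XsubC // => /eqP ->.
have sb'' : size b' == size r by apply/eqP.
by exists (Tuple sb'').
Qed.

(** * Conjugation of points and of factors *)

Section RealPoints.
Variables (R : rcfType) (n m : nat).
Hypothesis lt_mn : (m.+1 < n)%N.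
Variables (gamma : n.-tuple {poly_n R}).
Hypothesis hgamma : rational_normal_curve gamma.
Variables (t : n.-1.-tuple R[i]) (f : {poly R[i]}).
Hypotheses (t_uniq : uniq t) (f_size : size f = n)
  (f_roots : forall z, root f z = (z \in t)).
Local Notation Psi := (osc_poly (affine_component gamma)).
Local Notation Finf := (osculating_flag_infty gamma m.+1).
Local Notation conjp := (map_poly (@conjc R)).
Implicit Types A B : {poly R[i]}.

Definition factor_space A : {vspace 'rV[R[i]]_n} := apolar_space n m Psi f A.

Let n_gt0 : (0 < n)%N. Proof. exact: leq_trans lt_mn. Qed.

Let Psi_size v : (size (Psi v) <= n)%N. Proof. exact: size_osc_poly. Qed.

Let Psi_surj (p : {poly R[i]}) : (size p <= n)%N -> exists v, Psi v = p.
Proof. exact/(osc_poly_surj n_gt0)/coef_matrix_unit. Qed.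

Let mem_Finf v : (v \in Finf) = (size (Psi v) <= m.+1)%N.
Proof. exact/(mem_osculating_flag_infty lt_mn)/ltnW. Qed.

Let dim_Finf : \dim Finf = m.+1.
Proof. exact/(dim_osculating_flag_infty lt_mn)/ltnW. Qed.

Let Psi_conj v : Psi (map_mx (@conjc R) v) = conjp (Psi v).
Proof. exact/osc_poly_conj/coef_matrix_real. Qed.

Lemma factor_space_instance A B :
    A \is monic -> size A = m.+1 -> f^`() = A * B ->
  osculating_instance gamma m.+1 t (factor_space A).
Proof.
move=> mA sA df; apply/(osculating_instanceP lt_mn hgamma).
exact: (apolar_space_instance lt_mn Psi_size Psi_surj mem_Finf dim_Finf
  f_size f_roots mA sA df).
Qed.

Lemma osculating_instance_factor H : osculating_instance gamma m.+1 t H ->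
  exists A B, [/\ A \is monic, size A = m.+1, f^`() = A * B & H = factor_space A].
Proof.
move/(osculating_instanceP lt_mn hgamma).
apply: polynomial_instance_factor => //; last by rewrite size_tuple.
by move=> v; apply: (osc_poly_inj n_gt0 (coef_matrix_unit hgamma)).
Qed.

Lemma mem_factor_space A v : size A = m.+1 -> v \in Finf ->
  (v \in factor_space A) = (apolar m A (Psi v) == 0).
Proof.
move=> sA; apply: (apolar_space_Finf lt_mn Psi_size mem_Finf f_size).
by rewrite sA.
Qed.

(** Inside [Finf] the space is the kernel of the form, and that kernel determines a monic factor of
    degree [m]. *)
Lemma factor_space_inj A A' : A \is monic -> size A = m.+1 ->
  A' \is monic -> size A' = m.+1 -> factor_space A = factor_space A' -> A = A'.
Proof.
move=> mA sA mA' sA' eAA'; apply: (apolar_kernel_inj mA sA mA' sA') => p sp.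
have [v Dv] := Psi_surj (leq_trans sp (ltnW lt_mn)).
have vF : v \in Finf by rewrite mem_Finf Dv.
rewrite -Dv => /eqP; rewrite -(mem_factor_space sA vF) eAA'.
by rewrite (mem_factor_space sA' vF) => /eqP.
Qed.

(** The form commutes with conjugation, so whatever [A'] annihilates in degree at most [m] is
    annihilated by the conjugate of [A]. *)
Lemma conj_factor_space A A' : A \is monic -> size A = m.+1 ->
    A' \is monic -> size A' = m.+1 ->
  conj_vspace (factor_space A) = factor_space A' -> A' = conjp A.
Proof.
move=> mA sA mA' sA' eAA'.
apply: (apolar_kernel_inj mA' sA'); rewrite ?size_map_poly //.
  by rewrite map_monic.
move=> p sp; have [v Dv] := Psi_surj (leq_trans sp (ltnW lt_mn)).
have vF : v \in Finf by rewrite mem_Finf Dv.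
have wF : map_mx (@conjc R) v \in Finf.
  by rewrite mem_Finf Psi_conj size_map_poly Dv.
rewrite -Dv => /eqP; rewrite -(mem_factor_space sA' vF) -eAA' memv_conj_vspace.
rewrite (mem_factor_space sA wF) Psi_conj => /eqP/(congr1 conjp).
rewrite map_apolar rmorph0 -map_poly_comp (eq_map_poly (@conjcK R)).
by rewrite [map_poly id _]map_poly_id.
Qed.

(** Take [g] with image [f]. Its conjugate stays in the space, so the conjugate of [f] is [b *: f];
    monicity of the derivative gives [b = 1], and cancelling the real factor [A] leaves [B] real. *)
Lemma real_point_factor A B : f^`() \is monic ->
    A \is monic -> size A = m.+1 -> f^`() = A * B ->
    real_point (factor_space A) ->
  conjp A = A /\ conjp B = B.
Proof.
move=> mf mA sA df /esym rA.
have Ar := esym (conj_factor_space mA sA mA sA rA); split=> //.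
have [g Dg] := apolar_preimage_f lt_mn Psi_surj f_size mA sA df.
have : map_mx (@conjc R) g \in factor_space A.
  rewrite -memv_conj_vspace rA; apply/(apolar_spaceP Psi_size f_size).
    by rewrite sA.
  by exists 1; rewrite scale1r.
case/(apolar_spaceP Psi_size f_size) => [|b]; first by rewrite sA.
rewrite /= Psi_conj -{1}Ar -map_apolar Dg => fb.
have dfb : conjp f^`() = b *: f^`() by rewrite -deriv_map fb derivZ.
have b1 : b = 1.
  have := congr1 lead_coef dfb; rewrite lead_coefZ (monicP mf) mulr1 => <-.
  by apply/monicP; rewrite map_monic.
move: dfb; rewrite b1 scale1r df rmorphM /= Ar; exact/mulfI/monic_neq0.
Qed.

End RealPoints.

(** * Counting the real points *)

Theorem theorem3p4p2 (R : realType) (n k : nat) (hkn : (0 < k < n)%N)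
    (gamma : n.-tuple {poly_n R}) (hgamma : rational_normal_curve gamma)
    (t : n.-1.-tuple R[i]) (t_distinct : uniq t)
    (X_real : conj_stable (osculating_instance gamma k t))
    (f : {poly R[i]}) (f_degree : size f = n)
    (f_roots : forall z : R[i], root f z = (z \in t))
    (f'_monic : f^`() \is monic) :
  let X := osculating_instance gamma k t in
  finite_set [set H | X H /\ real_point H] /\
  [set H | X H /\ real_point H] #= real_factorizations f^`() (n - k - 1) (k - 1).
Proof.
case: k hkn X_real => // m lt_mn X_real X; move: lt_mn; rewrite andTb => lt_mn.
rewrite [(m.+1 - 1)%N]subn1 /=; set T := real_factorizations _ _ _.
pose toC : {poly R} -> {poly R[i]} := map_poly (real_complex R).
(* The point is built from the second factor, the one of degree [m]; cancelling it in the derivative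
   of [f] recovers the first. *)
pose psi (AB : {poly R} * {poly R}) := factor_space m gamma f (toC AB.2).
have TP AB : T AB -> [/\ toC AB.2 \is monic, size (toC AB.2) = m.+1 &
    f^`() = toC AB.2 * toC AB.1].
  case=> _ mB _ sB df; rewrite /toC map_monic size_map_poly; split=> //.
  by rewrite df rmorphM mulrC.
have -> : [set H | X H /\ real_point H] = psi @` T.
  apply/seteqP; split=> [H [XH rH]|_ [AB TAB <-]].
    have [A [B [mA sA df HA]]] :=
      osculating_instance_factor lt_mn hgamma t_distinct f_degree f_roots XH.
    rewrite HA in rH.
    have [] := real_point_factor lt_mn hgamma f_degree f'_monic mA sA df rH.
    move=> /conj_poly_real[A0 DA] /conj_poly_real[B0 DB].
    have mB : B \is monic by rewrite -(monicMl _ mA) -df.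
    exists (B0, A0); last by rewrite /psi /toC /= -DA.
    split=> /=; rewrite -?(map_monic (real_complex R)) -?DA -?DB //.
    - rewrite -(size_map_poly (real_complex R)) -DB.
      have : size f^`(1) = size (A * B) by rewrite derivn1 df.
      rewrite size_derivn f_degree size_Mmonic ?monic_neq0 // sA.
      have := size_poly_gt0 B; rewrite monic_neq0 //; set b := size B; lia.
    - by rewrite -(size_map_poly (real_complex R)) -DA.
    - by rewrite df rmorphM /= -DA -DB mulrC.
  have [mA sA df] := TP _ TAB.
  have XH : X (psi AB) by apply: factor_space_instance df.
  (* Stability of [X] puts the conjugate point in [X], so it comes from some factor; this factor is
     the conjugate of a real polynomial, hence that polynomial itself. *)
  split=> //; have : X (conj_vspace (psi AB)) by apply: X_real; exists (psi AB).
  case/(osculating_instance_factor lt_mn hgamma t_distinct f_degree f_roots).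
  move=> A [B [mA' sA' _ HA]]; rewrite /real_point HA.
  congr (factor_space m gamma f _).
  rewrite (conj_factor_space lt_mn hgamma f_degree mA sA mA' sA' HA).
  exact: esym (map_real_conj _).
have psi_inj : {in T &, injective psi}.
  move=> [A B] [A' B'] /set_mem TAB /set_mem TAB' e.
  have [mB sB df] := TP _ TAB; have [mB' sB' df'] := TP _ TAB'.
  have := factor_space_inj lt_mn hgamma f_degree mB sB mB' sB' e.
  move=> /= BB; have /= {}BB := map_poly_inj _ BB.
  move: df; rewrite df' /= BB => AA; have {}AA := mulfI (monic_neq0 mB') AA.
  by have /= -> := map_poly_inj _ AA.
have cardT := inj_card_eq psi_inj; split=> //.
rewrite (eq_finite_set cardT).
(* The real points lie among the spaces attached to the finitely many complex monic divisors of the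
   derivative. *)
have : finite_set [set A : {poly R[i]} | A \is monic /\ A %| f^`()].
  exact/finite_monic_divisors/monic_neq0.
move/(finite_image (factor_space m gamma f)); rewrite -(eq_finite_set cardT).
apply: sub_finite_set => _ [AB /TP[mA sA df] <-]; exists (toC AB.2) => //.
by split=> //; rewrite df dvdp_mulIl.
Qed.
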